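(* Let $\mathbb{F}$ be any field of characteristic $0$ and let $n\geq 1$ be an integer. Then every biderivation $\delta$ of the Witt algebra $\mathcal{W}^+_n=\mathrm{Der}(\mathbb{F}[t_1,\ldots,t_n])$ is of the form $\delta(x,y)=\lambda[x,y]$ for all $x,y\in\mathcal{W}^+_n$, for some $\lambda\in\mathbb{F}$.
   Context: For a Lie algebra $L$ over a field $\mathbb{F}$, a biderivation of $L$ is an $\mathbb{F}$-bilinear map $\delta:L\times L\to L$ (not assumed symmetric or skew-symmetric) such that for all $x,y,z\in L$: $\delta([x,y],z)=[x,\delta(y,z)]-[y,\delta(x,z)]$ and $\delta(x,[y,z])=[\delta(x,y),z]+[y,\delta(x,z)]$. $\mathcal{W}^+_n$ is the Lie algebra of $\mathbb{F}$-derivations of the polynomial algebra $A_n=\mathbb{F}[t_1,\ldots,t_n]$. With $d_i=\frac{\partial}{\partial t_i}$ we have $\mathcal{W}^+_n=\bigoplus_{i=1}^n A_n d_i$ and $[fd_i,gd_j]=fd_i(g)d_j-gd_j(f)d_i$ for $f,g\in A_n$. *)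

(* Defs.v *)
From HB Require Import structures.
From mathcomp Require Import all_boot all_order all_algebra.
From mathcomp Require Import boolp classical_sets functions.
From mathcomp Require Import mpoly.

Set Implicit Arguments.
Unset Strict Implicit.
Unset Printing Implicit Defensive.

Import GRing.Theory.
Local Open Scope ring_scope.

HB.mixin Record Lmodule_isLieAlgebra (F : fieldType) L
    of GRing.Lmodule F L := {
  lie : L -> L -> L;
  lie_is_linearl : forall y, linear (lie^~ y);
  lie_is_linearr : forall x, linear (lie x);
  liexx : forall x, lie x x = 0;
  lie_jacobi : forall x y z,
    lie x (lie y z) + lie y (lie z x) + lie z (lie x y) = 0
}.

#[short(type="lieAlgType")]
HB.structure Definition LieAlgebra (F : fieldType) :=
  { L of GRing.Lmodule F L & Lmodule_isLieAlgebra F L }.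

Notation "[lie x , y ]" := (lie x y)
  (at level 0, x at level 99, y at level 99, format "[lie  x ,  y ]")
  : ring_scope.

Definition biderivation (F : fieldType) (L : lieAlgType F)
    (delta : {bilinear L -> L -> L}) : Prop :=
  (forall x y z : L,
     delta [lie x, y] z = [lie x, delta y z] - [lie y, delta x z]) /\
  (forall x y z : L,
     delta x [lie y, z] = [lie delta x y, z] + [lie y, delta x z]).

Section Derivations.
Variables (F : fieldType) (A : algType F).

Definition is_derivation (D : A -> A) : Prop :=
  linear D /\ forall a b : A, D (a * b) = D a * b + a * D b.

Definition derivation_pred : {pred A -> A} := fun D => `[< is_derivation D >].

Lemma derivationP (D : A -> A) :
  reflect (is_derivation D) (D \in derivation_pred).
Proof. exact: asboolP. Qed.

Lemma derivation_submod_closed : submod_closed derivation_pred.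
Proof.
split.
  apply/derivationP; split=> [c a b|a b].
    by rewrite /= scaler0 addr0.
  by rewrite /= mul0r mulr0 addr0.
move=> c D E /derivationP[linD mulD] /derivationP[linE mulE].
apply/derivationP; split=> [k a b|a b]; rewrite !fctE.
  by rewrite linD linE !scalerDr !scalerA (mulrC c k) addrACA.
by rewrite mulD mulE scalerDr mulrDl mulrDr -scalerAl -scalerAr addrACA.
Qed.

HB.instance Definition _ :=
  GRing.isSubmodClosed.Build F (A -> A) derivation_pred
    derivation_submod_closed.

Record Der : Type := MkDer {
  der_fun :> A -> A;
  der_funP : der_fun \in derivation_pred
}.

HB.instance Definition _ := [isSub for der_fun].
HB.instance Definition _ := [Choice of Der by <:].
HB.instance Definition _ := [SubChoice_isSubLmodule of Der by <:].

Definition commutator (D E : A -> A) : A -> A := fun a => D (E a) - E (D a).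

Lemma commutator_derivation (D E : Der) :
  commutator D E \in derivation_pred.
Proof.
case: D E => [D /derivationP[linD mulD]] [E /derivationP[linE mulE]] /=.
have addD a b : D (a + b) = D a + D b by have := linD 1 a b; rewrite !scale1r.
have addE a b : E (a + b) = E a + E b by have := linE 1 a b; rewrite !scale1r.
apply/derivationP; split=> [k a b|a b]; rewrite /commutator.
  by rewrite linE linD (linD k) (linE k) scalerBr opprD addrACA.
rewrite mulE mulD addD addE !mulD !mulE.
rewrite (AC (2*2) (1*4*(2*3))) [X in _ - X](AC (2*2) (1*4*(3*2))) /=.
by rewrite opprD [LHS]addrACA subrr addr0 opprD addrACA -mulrBl -mulrBr.
Qed.

Definition der_lie (D E : Der) : Der := MkDer (commutator_derivation D E).

Lemma der_eqP (D E : Der) : D =1 E -> D = E.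
Proof. by move=> eqDE; apply: val_inj; apply: funext. Qed.

Lemma der_linear (D : Der) : linear D.
Proof. by have /derivationP[] := der_funP D. Qed.

Lemma der_addE (D E : Der) a : (D + E) a = D a + E a.
Proof. by []. Qed.

Lemma der_scaleE (c : F) (D : Der) a : (c *: D) a = c *: D a.
Proof. by []. Qed.

Lemma der_lieE (D E : Der) a : der_lie D E a = D (E a) - E (D a).
Proof. by []. Qed.

Fact der_lie_linearr (D : Der) : linear (der_lie D).
Proof.
move=> c E G; apply: der_eqP => a.
rewrite der_addE der_scaleE !der_lieE !der_addE !der_scaleE der_linear.
by rewrite scalerBr opprD addrACA.
Qed.

Fact der_lie_linearl (D : Der) : linear (der_lie^~ D).
Proof.
move=> c E G; apply: der_eqP => a.
rewrite der_addE der_scaleE !der_lieE !der_addE !der_scaleE der_linear.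
by rewrite scalerBr opprD addrACA.
Qed.

Fact der_liexx (D : Der) : der_lie D D = 0.
Proof. by apply: der_eqP => a; rewrite der_lieE subrr. Qed.

Fact der_lie_jacobi (D E G : Der) :
  der_lie D (der_lie E G) + der_lie E (der_lie G D)
  + der_lie G (der_lie D E) = 0.
Proof.
have derB (H : Der) x y : H (x - y) = H x - H y.
  by rewrite addrC -scaleN1r der_linear scaleN1r addrC.
apply: der_eqP => a; rewrite !der_addE !der_lieE !derB.
rewrite !opprB.
rewrite (AC ((2*2)*(2*2)*(2*2))
  ((1*12)*(7*2)*(3*10)*(5*4)*(11*6)*(9*8))) /=.
by rewrite !subrr !addr0.
Qed.

HB.instance Definition _ :=
  Lmodule_isLieAlgebra.Build F Der
    der_lie_linearl der_lie_linearr der_liexx der_lie_jacobi.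

End Derivations.

Notation Witt F n := (Der {mpoly F[n]}).

(* Main.v *)
Require Import Defs.
From HB Require Import structures.
From mathcomp Require Import all_boot all_order all_algebra.
From mathcomp Require Import ring.
From mathcomp Require Import mpoly.

(** A derivation of the Lie algebra is determined by its values on the
    partials [d_i] and on the Euler field [E = \sum_k t_k d_k] (induct on the
    degree of monomial fields), so a biderivation [delta] is determined by its
    values on pairs of these.  At a point [c], let [E_c = \sum_k (t_k - c_k) d_k]
    and [x = (t_l - c_l) E_c], which vanishes to order two at [c].  For any
    derivation [T], the value at [c] of [[d_j, T x]] depends only on that of
    [T E_c].  Substituting [x], [d_i], [d_j], [E_c] in the four-variable identity
    [biderivation_lie4] then gives, at the point [c],
    [delta d_i E_c = Lambda d_i], [delta E_c d_j = - Lambda d_j] and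
    [delta E_c E_c = 0], with [Lambda] polynomial in [c].  Writing
    [E_c = E - \sum_k c_k d_k], these become identities between polynomial
    fields, and applying the Euler operator to them forces [E Lambda = 0], so
    that [Lambda] is a constant, and then [delta d_i d_j = 0]. *)

Set Implicit Arguments.
Unset Strict Implicit.
Unset Printing Implicit Defensive.

Import GRing.Theory.
Local Open Scope ring_scope.

(** * Polynomials that vanish at every point *)

(** Reduction modulo [B] isolates the lowest digit; cancelling it and one factor [B] leaves the same
    equality for the remaining digits. *)
Lemma radix_inj (B n : nat) (a b : 'I_n -> nat) :
    (forall i, a i < B)%N -> (forall i, b i < B)%N ->
  (\sum_i a i * B ^ i = \sum_i b i * B ^ i)%N -> a =1 b.
Proof.
elim: n a b => [|n IHn] a b aB bB; first by move=> _ [].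
have B_gt0 : (0 < B)%N by apply: leq_ltn_trans (aB ord0).
have split_sum (c : 'I_n.+1 -> nat) : (\sum_i c i * B ^ i
    = (\sum_(i < n) c (lift ord0 i) * B ^ i) * B + c ord0)%N.
  rewrite big_ord_recl expn0 muln1 addnC big_distrl; congr (_ + _)%N.
  by apply: eq_bigr => i _; rewrite /= -mulnA -expnSr.
rewrite !split_sum => eq_ab.
have eq0 : a ord0 = b ord0.
  by move/(congr1 (modn^~ B)): eq_ab; rewrite !modnMDl !modn_small.
move: eq_ab; rewrite eq0 => /addIn/eqP; rewrite eqn_pmul2r // => /eqP eqS.
move=> i; case: (unliftP ord0 i) => [j ->|-> //].
by apply: (IHn (a \o lift ord0) (b \o lift ord0)) => // l; [apply: aB | apply: bB].
Qed.

Section CharZero.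
Variables (F : fieldType) (charF0 : [pchar F] =i pred0).

Lemma natrF_eq0 (k : nat) : (k%:R == 0 :> F) = (k == 0%N).
Proof. exact: (pcharf0P F).1. Qed.

Lemma natrF_inj : injective (fun k : nat => k%:R : F).
Proof.
suff wlog_le i j : (i <= j)%N -> i%:R = j%:R :> F -> i = j.
  by move=> i j; case/orP: (leq_total i j) => le /[dup] e;
     [|move/esym]; move/(wlog_le _ _ le).
move=> le_ij /esym/eqP; rewrite -subr_eq0 -natrB // natrF_eq0 subn_eq0 => le_ji.
by apply/eqP; rewrite eqn_leq le_ij.
Qed.

(** In characteristic zero the images of [0, ..., size g - 1] are distinct, hence too many roots for
    a nonzero [g]. *)
Lemma poly_vanish_eq0 (g : {poly F}) : (forall x, g.[x] = 0) -> g = 0.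
Proof.
move=> g0; apply/eqP; apply: contraT => nz_g.
have /max_poly_roots: g != 0 by [].
move=> /(_ [seq k%:R | k <- iota 0 (size g)]).
rewrite (map_inj_uniq natrF_inj) iota_uniq size_map size_iota ltnn.
by apply=> //; apply/allP => x _; rewrite rootE g0.
Qed.

(* Kronecker substitution [t_i := x ^ (B ^ i)], with [B] larger than every
   exponent of [p], sends distinct monomials of [p] to distinct powers of [x]. *)
Lemma mpoly_vanish_eq0 (n : nat) (p : {mpoly F[n]}) :
  (forall v : 'I_n -> F, p.@[v] = 0) -> p = 0.
Proof.
move=> p0; pose B := msize p; pose code m := (\sum_(i < n) m i * B ^ i)%N.
pose g := \sum_(m <- msupp p) p@_m *: 'X^(code m) : {poly F}.
have code_inj m m' : m \in msupp p -> m' \in msupp p -> code m = code m' -> m = m'.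
  have small m1 : m1 \in msupp p -> forall i : 'I_n, (m1 i < B)%N.
    move=> /msize_mdeg_lt lt_m i; apply: leq_ltn_trans lt_m.
    by rewrite mdegE (bigD1 i) //= leq_addr.
  move=> /small mB /small m'B eq_c; apply/mnmP.
  exact: (radix_inj mB m'B eq_c).
have g0 : g = 0.
  apply: poly_vanish_eq0 => x; rewrite -(p0 (fun i => x ^+ (B ^ i))) mevalE.
  rewrite horner_sum; apply: eq_bigr => m _.
  rewrite hornerZ hornerXn; congr (_ * _).
  under [RHS]eq_bigr do rewrite -exprM mulnC.
  by rewrite expr_sum.
apply/mpolyP => m; rewrite mcoeff0; apply/eqP; rewrite mcoeff_eq0.
apply/negP => supp_m; have := mcoeff_msupp p m; rewrite supp_m => /esym/eqP[].
move/(congr1 (fun q : {poly F} => q`_(code m))): g0.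
rewrite coef0 coef_sum (bigD1_seq m) ?msupp_uniq //= coefZ coefXn eqxx mulr1.
rewrite big_seq_cond big1 ?addr0 // => m' /andP[supp_m' neq_m'].
rewrite coefZ coefXn; case: eqP => [/code_inj eq_m|]; last by rewrite mulr0.
by rewrite (eq_m supp_m supp_m') eqxx in neq_m'.
Qed.

End CharZero.

(** * Identities in Lie algebras and for biderivations *)

Section LieTheory.
Variables (F : fieldType) (L : lieAlgType F).
Implicit Types x y z : L.

Fact lie_is_bilinear : bilinear_for
  (GRing.Scale.Law.clone _ _ *:%R _) (GRing.Scale.Law.clone _ _ *:%R _)
  (@lie F L).
Proof. by split=> [y|x]; [apply: lie_is_linearl | apply: lie_is_linearr]. Qed.

HB.instance Definition _ :=
  bilinear_isBilinear.Build F L L L _ _ (@lie F L) lie_is_bilinear.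

Lemma lie_antisym x y : [lie y, x] = - [lie x, y].
Proof.
apply/eqP; rewrite -addr_eq0; have := liexx (x + y).
by rewrite linearDl !linearDr /= !liexx add0r addr0 addrC => ->.
Qed.

Lemma lieNl x y : [lie - x, y] = - [lie x, y]. Proof. exact: linearNl. Qed.

Lemma lieNr x y : [lie x, - y] = - [lie x, y]. Proof. exact: linearNr. Qed.

(** The Jacobi identity in Leibniz form: [lie x] is a derivation of [L]. *)
Lemma lie_lie x y z : [lie x, [lie y, z]] = [lie [lie x, y], z] + [lie y, [lie x, z]].
Proof.
rewrite (lie_antisym z [lie x, y]) (lie_antisym z x) lieNr -opprD.
by apply/eqP; rewrite -addr_eq0 addrA addrAC lie_jacobi.
Qed.

(* Both sides come from expanding [delta [x, u] [y, v]], starting with the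
   first or with the second argument. *)
Lemma biderivation_lie4 (delta : {bilinear L -> L -> L}) (x u y v : L) :
    biderivation delta ->
  [lie delta u y, [lie x, v]] + [lie [lie x, y], delta u v]
  = [lie delta x y, [lie u, v]] + [lie [lie u, y], delta x v].
Proof.
case=> dl dr; have := dl x u [lie y, v]; rewrite {1}dr !dl !dr.
rewrite linearBl linearBr !linearDr /= !(lie_lie x) !(lie_lie u).
(* The expansion on the right contains every term of the one on the left; what remains adds up to
   zero. *)
rewrite (addrC _ [lie y, [lie x, _]]) (addrC _ [lie y, [lie u, _]]).
rewrite [LHS]addrACA -opprD [X in _ = X - _]addrACA [X in _ = _ - X]addrACA.
rewrite [X in _ = _ + X]opprD [RHS]addrACA -[LHS]addr0.
by move=> /addrI/esym/eqP; rewrite subr_eq0 => /eqP.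
Qed.
End LieTheory.

(** * Polynomial vector fields, partials and Euler fields *)

Section Witt.
Variables (F : fieldType) (n : nat).
Local Notation A := {mpoly F[n]}.
Implicit Types (D w : Witt F n) (p q : A).

Lemma mderivU (i j : 'I_n) : ('X_j : A)^`M(i) = (i == j)%:R.
Proof.
rewrite mderivX mnm1E eq_sym; case: eqP => [->|_]; last by rewrite scale0r.
have -> : (U_(j) - U_(j) = 0)%MM by apply/mnmP => k; rewrite mnmBE subnn mnm0E.
by rewrite mpolyX0 scale1r.
Qed.

Fact der_is_linear D : linear D. Proof. exact: der_linear. Qed.
HB.instance Definition _ D :=
  GRing.isLinear.Build F A A *:%R D (der_is_linear D).

Lemma derM D p q : D (p * q) = D p * q + p * D q.
Proof. by have /derivationP[_] := der_funP D. Qed.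

Lemma der1 D : D 1 = 0.
Proof.
by have := derM D 1 1; rewrite !mul1r mulr1 => /esym/eqP; rewrite -subr_eq0 addrK => /eqP.
Qed.

(** Both sides are linear, obey the product rule and agree on the variables, hence on monomials and
    then everywhere. *)
Lemma der_mderivE D p : D p = \sum_i D 'X_i * p^`M(i).
Proof.
pose G q := \sum_i D 'X_i * q^`M(i).
have GD a q r : G (a *: q + r) = a *: G q + G r.
  rewrite /G scaler_sumr -big_split; apply: eq_bigr => i _.
  by rewrite /= linearP mulrDr scalerAr.
have GM q r : G (q * r) = G q * r + q * G r.
  rewrite /G mulr_suml mulr_sumr -big_split; apply: eq_bigr => i _.
  by rewrite /= mderivM; ring.
have G1 : G 1 = 0.
  by rewrite /G big1 // => i _; rewrite -mpolyC1 mderivC mulr0.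
have GX i : D 'X_i = G 'X_i.
  rewrite /G (bigD1 i) //= mderivU eqxx mulr1 big1 ?addr0 // => j.
  by move=> /negPf neq_ji; rewrite mderivU neq_ji mulr0.
rewrite -/(G p); elim/mpolyind: p => [|c m p _ _ IHp].
  by rewrite linear0 /G big1 // => i _; rewrite mderiv0 mulr0.
rewrite linearP GD /= IHp; congr (_ *: _ + _) => {c p IHp}.
rewrite mpolyXE_id; elim/big_ind: _ => [|q r Dq Dr|i _]; first by rewrite der1.
  by rewrite derM GM Dq Dr.
elim: (m i) => [|k IHk]; first by rewrite expr0 der1.
by rewrite exprS derM GM IHk GX.
Qed.

Lemma der_ext D w : (forall i, D 'X_i = w 'X_i) -> D = w.
Proof.
by move=> eqX; apply: der_eqP => p; rewrite !der_mderivE; apply: eq_bigr => i _; rewrite eqX.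
Qed.

Fact vfield_subproof (f : 'I_n -> A) : {D : Witt F n | forall i, D 'X_i = f i}.
Proof.
pose Df (p : A) := \sum_i f i * p^`M(i).
have Df_der : Df \in derivation_pred (A := A).
  apply/derivationP; split=> [a p q|p q]; rewrite /Df.
    rewrite scaler_sumr -big_split; apply: eq_bigr => i _.
    by rewrite /= linearP mulrDr scalerAr.
  rewrite mulr_suml mulr_sumr -big_split; apply: eq_bigr => i _.
  by rewrite /= mderivM; ring.
exists (MkDer Df_der) => i; rewrite /= /Df (bigD1 i) //= mderivU eqxx mulr1.
by rewrite big1 ?addr0 // => j /negPf neq_ji; rewrite mderivU neq_ji mulr0.
Qed.

(** The field [\sum_i f i d_i]. Its construction is opaque; it is used only through its values on
    the variables. *)
Definition vfield f : Witt F n := sval (vfield_subproof f).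

Lemma vfieldX f i : vfield f 'X_i = f i.
Proof. exact: (svalP (vfield_subproof f)). Qed.

Lemma derB D p q : D (p - q) = D p - D q. Proof. exact: linearB. Qed.

Lemma derD D p q : D (p + q) = D p + D q. Proof. exact: linearD. Qed.

Lemma derZ D a p : D (a *: p) = a *: D p. Proof. exact: linearZ. Qed.

Lemma der_oppE D p : (- D) p = - D p. Proof. by []. Qed.

Lemma lieE D w p : [lie D, w] p = D (w p) - w (D p).
Proof. by []. Qed.

Lemma der_sumE (I : Type) (r : seq I) (E : I -> Witt F n) p :
  (\sum_(i <- r) E i) p = \sum_(i <- r) E i p.
Proof. by elim/big_rec2: _ => // i y1 y2 _ <-. Qed.

Lemma der_mpolyC D a : D a%:MP = 0.
Proof. by rewrite -[a%:MP]mulr1 mul_mpolyC linearZ /= der1 scaler0. Qed.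

Lemma der_nat D k : D k%:R = 0.
Proof. by rewrite -mpolyC_nat der_mpolyC. Qed.

Definition partial (i : 'I_n) : Witt F n := vfield (fun k => (i == k)%:R).

Definition euler (c : 'I_n -> F) : Witt F n := vfield (fun k => 'X_k - (c k)%:MP).

Lemma partialE i p : partial i p = p^`M(i).
Proof.
rewrite der_mderivE (bigD1 i) //= [X in X * _]vfieldX eqxx mul1r big1 ?addr0 //.
by move=> j /negPf neq_ji; rewrite [X in X * _]vfieldX eq_sym neq_ji mul0r.
Qed.

Lemma lie_partialX i w k : [lie partial i, w] 'X_k = (w 'X_k)^`M(i).
Proof. by rewrite lieE partialE vfieldX der_nat subr0. Qed.

Lemma lie_euler0X w k :
  [lie euler (fun=> 0), w] 'X_k = euler (fun=> 0) (w 'X_k) - w 'X_k.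
Proof. by rewrite lieE vfieldX mpolyC0 subr0. Qed.

Lemma lie_partial i j : [lie partial i, partial j] = 0.
Proof. by apply: der_ext => k; rewrite lieE !vfieldX !der_nat subr0. Qed.

Lemma lie_euler_partial c i : [lie euler c, partial i] = - partial i.
Proof.
apply: der_ext => k.
by rewrite der_oppE lieE !vfieldX der_nat sub0r derB der_mpolyC subr0 vfieldX.
Qed.

Lemma lie_partial_euler c i : [lie partial i, euler c] = partial i.
Proof. by rewrite lie_antisym lie_euler_partial opprK. Qed.

(** By bilinearity this makes the values of [delta] on [E_c] polynomial in [c]. *)
Lemma euler_shift c : euler c = euler (fun=> 0) - \sum_i c i *: partial i.
Proof.
apply: der_ext => k; rewrite der_addE der_oppE der_sumE !vfieldX mpolyC0 subr0.
under eq_bigr do rewrite der_scaleE vfieldX.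
rewrite (bigD1 k) //= eqxx big1 => [|j /negPf ->]; last by rewrite scaler0.
by rewrite addr0 -mul_mpolyC mulr1.
Qed.

(** The field [(t_l - c_l) E_c], called [x] in the overview. *)
Definition quad c l : Witt F n :=
  vfield (fun k => ('X_l - (c l)%:MP) * ('X_k - (c k)%:MP)).

Lemma lie_euler_quad c l : [lie euler c, quad c l] = quad c l.
Proof.
apply: der_ext => k; rewrite lieE !vfieldX derM !derB !der_mpolyC !subr0 !vfieldX.
by rewrite addrK.
Qed.

(** * Values of fields and of their brackets at a point *)

Definition value c w (k : 'I_n) : F := (w 'X_k).@[c].

Lemma valueN c w k : value c (- w) k = - value c w k.
Proof. by rewrite /value der_oppE mevalN. Qed.

Lemma valueD c w D k : value c (w + D) k = value c w k + value c D k.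
Proof. by rewrite /value der_addE mevalD. Qed.

Lemma value0 c k : value c 0 k = 0.
Proof. by rewrite /value meval0. Qed.

Lemma meval_der c w p : (w p).@[c] = \sum_i value c w i * (p^`M(i)).@[c].
Proof.
rewrite der_mderivE raddf_sum /=; apply: eq_bigr => i _.
by rewrite mevalM.
Qed.

Lemma value_eq0 c w p : (forall k, value c w k = 0) -> (w p).@[c] = 0.
Proof. by move=> w0; rewrite meval_der big1 // => i _; rewrite w0 mul0r. Qed.

Lemma value_euler c k : value c (euler c) k = 0.
Proof. by rewrite /value vfieldX mevalB mevalXU mevalC subrr. Qed.

Lemma value_quad c l k : value c (quad c l) k = 0.
Proof. by rewrite /value vfieldX mevalM !mevalB !mevalXU !mevalC !subrr mulr0. Qed.

(** At [c] the field [E_c] vanishes and its linear part is the identity. *)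
Lemma value_lie_euler c w k : value c [lie euler c, w] k = - value c w k.
Proof.
rewrite /value lieE mevalB vfieldX derB der_mpolyC subr0 value_eq0 ?sub0r //.
exact: value_euler.
Qed.

(** [quad c l] vanishes to order two at [c], so neither half of the bracket survives there. *)
Lemma value_lie_quad c l w k : value c [lie quad c l, w] k = 0.
Proof.
rewrite /value lieE mevalB vfieldX derM !derB !der_mpolyC !subr0.
rewrite value_eq0 ?sub0r; last exact: value_quad.
by rewrite mevalD !mevalM !mevalB !mevalXU !mevalC !subrr mul0r mulr0 addr0 oppr0.
Qed.

Lemma lie_partial_quadX c j l k : [lie partial j, quad c l] 'X_k
  = (j == l)%:R * ('X_k - (c k)%:MP) + ('X_l - (c l)%:MP) * (j == k)%:R.
Proof.
by rewrite lieE !vfieldX der_nat subr0 derM !derB !der_mpolyC !subr0 !vfieldX.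
Qed.

(** [[d_j, quad c l]] vanishes at [c], so the bracket is minus its Jacobian applied to the value of
    [w]. *)
Lemma value_lie_partial_quad c j l w k :
  value c [lie [lie partial j, quad c l], w] k
  = - ((j == l)%:R * value c w k + (j == k)%:R * value c w l).
Proof.
rewrite /value lieE mevalB value_eq0 => [|i].
  rewrite sub0r lie_partial_quadX derD !derM !derB !der_mpolyC !der_nat !subr0.
  by rewrite mul0r add0r mulr0 addr0 mevalD !mevalM !rmorph_nat; ring.
rewrite /value lie_partial_quadX mevalD !mevalM !mevalB !mevalXU !mevalC !subrr.
by rewrite mul0r mulr0 addr0.
Qed.

(** * Derivations of the Lie algebra, at a point *)

Definition lie_derivation (T : Witt F n -> Witt F n) :=
  forall a b, T [lie a, b] = [lie T a, b] + [lie a, T b].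

Section LieDerivation.
Variables (T : Witt F n -> Witt F n) (derT : lie_derivation T).

Lemma lie_derivation0 : T 0 = 0.
Proof.
have /esym := derT 0 0; rewrite liexx !(linear0l, linear0r) addr0 //.
Qed.

(** The field [g = [d_j, quad c l]] commutes with [E_c]. Applying [T] to [[E_c, g] = 0] and
    evaluating at [c] expresses the value of [T g] through that of [T E_c]; [[T d_j, quad c l]]
    vanishes at [c], so [T g] and [[d_j, T (quad c l)]] agree there. *)
Lemma value_lie_partial_derivation_quad c j l k :
  value c [lie partial j, T (quad c l)] k =
  (j == l)%:R * value c (T (euler c)) k + (j == k)%:R * value c (T (euler c)) l.
Proof.
pose g := [lie partial j, quad c l].
have euler_g : [lie euler c, g] = 0.
  by rewrite lie_lie lie_euler_partial lie_euler_quad lieNl addNr.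
have <- : value c (T g) k = value c [lie partial j, T (quad c l)] k.
  by rewrite derT valueD (lie_antisym (quad c l)) valueN value_lie_quad oppr0 add0r.
have /(congr1 (fun w => value c w k)) := derT (euler c) g.
rewrite euler_g lie_derivation0 value0 valueD value_lie_euler lie_antisym.
rewrite valueN value_lie_partial_quad opprK => /esym/eqP.
by rewrite subr_eq0 => /eqP.
Qed.

End LieDerivation.


(** * Derivations are determined by the partials and the Euler field *)

Lemma euler0E p : euler (fun=> 0) p = \sum_i 'X_i * p^`M(i).
Proof.
by rewrite der_mderivE; apply: eq_bigr => i _; rewrite vfieldX mpolyC0 subr0.
Qed.

Lemma euler0X (m : 'X_{1..n}) : euler (fun=> 0) 'X_[m] = (mdeg m)%:R *: 'X_[m].
Proof.
rewrite euler0E mdegE natr_sum scaler_suml; apply: eq_bigr => i _.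
rewrite mderivX -scalerAr -mpolyXD.
have [-> | m_gt0] := posnP (m i); first by rewrite !scale0r.
congr (_ *: 'X_[_]); apply/mnmP => j; rewrite mnmDE mnmBE mnm1E.
by case: eqP => [<-|_]; rewrite ?subn0 // subnKC.
Qed.

Section CharZeroWitt.
Hypothesis charF0 : [pchar F] =i pred0.

(** Monomials are eigenvectors of the Euler operator, with eigenvalue their degree, which is nonzero
    in [F] unless the monomial is [1]. *)
Lemma euler0_eq0 p : euler (fun=> 0) p = 0 -> p = (p@_0%MM)%:MP.
Proof.
move=> ep0; apply/mpolyP => m.
have : (mdeg m)%:R * p@_m = 0.
  rewrite -[RHS](mcoeff0 F m) -ep0 [in RHS](mpolyE p) linear_sum [RHS]raddf_sum /=.
  have [supp_m|] := boolP (m \in msupp p).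
    rewrite (bigD1_seq m) ?msupp_uniq //= derZ euler0X !mcoeffZ mcoeffX.
    rewrite eqxx mulr1 mulrC big1 ?addr0 // => m' /negPf neq_m'.
    by rewrite derZ euler0X !mcoeffZ mcoeffX neq_m' !mulr0.
  rewrite -mcoeff_eq0 => /eqP p_m; rewrite p_m mulr0 big_seq big1 // => m' supp_m'.
  rewrite derZ euler0X !mcoeffZ mcoeffX; case: eqP => [eq_m|]; last by rewrite !mulr0.
  by rewrite eq_m p_m mul0r.
move=> /eqP; rewrite mcoeffC mulf_eq0 (natrF_eq0 charF0) mdeg_eq0.
by case: eqP => [->|_ /= /eqP ->]; rewrite ?mulr1 ?mulr0.
Qed.

Definition monomial_field (m : 'X_{1..n}) k : Witt F n :=
  vfield (fun j => (k == j)%:R * 'X_[m]).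

Lemma der_decomposition w :
  w = \sum_k \sum_(m <- msupp (w 'X_k)) (w 'X_k)@_m *: monomial_field m k.
Proof.
apply: der_ext => j; rewrite der_sumE.
under eq_bigr do (rewrite der_sumE; under eq_bigr do rewrite der_scaleE vfieldX).
rewrite (bigD1 j) //= [X in _ + X]big1 ?addr0 => [|k /negPf neq_kj].
  by rewrite eqxx [LHS]mpolyE; apply: eq_bigr => m _; rewrite mul1r.
by rewrite neq_kj big1 // => m _; rewrite mul0r scaler0.
Qed.

(** By induction on the degree of [m], the difference [z] at [t^m d_k] commutes with all partials,
    so it is a constant field and [[E, z] = - z]. Agreement on [E] gives [[E, z] = (deg m - 1) z],
    hence [deg m * z = 0]. *)
Lemma lie_derivation_inj (T U : {linear Witt F n -> Witt F n}) :
    lie_derivation T -> lie_derivation U ->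
    (forall i, T (partial i) = U (partial i)) ->
    T (euler (fun=> 0)) = U (euler (fun=> 0)) ->
  T =1 U.
Proof.
move=> derT derU eq_partial eq_euler.
have lie_diff a w : T a = U a ->
    [lie a, T w - U w] = T [lie a, w] - U [lie a, w].
  by move=> eq_a; rewrite derT derU eq_a opprD addrACA subrr add0r linearBr.
suff eq_mon m k : T (monomial_field m k) = U (monomial_field m k).
  move=> w; rewrite (der_decomposition w) !linear_sum; apply: eq_bigr => k _.
  rewrite /= !linear_sum; apply: eq_bigr => m _.
  by rewrite !linearZ /= eq_mon.
move: {2}(mdeg m).+1 (ltnSn (mdeg m)) => d; elim: d m => // d IHd m lt_md.
have [m0|m_neq0] := eqVneq m 0%MM.
  suff -> : monomial_field m k = partial k by [].
  by apply: der_ext => j; rewrite !vfieldX m0 mpolyX0 mulr1.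
apply/eqP; rewrite -subr_eq0; apply/eqP; set z := T _ - U _.
(* Bracketing with [d_i] lowers the degree of the monomial field or kills it. *)
have partial_z i : [lie partial i, z] = 0.
  rewrite lie_diff //; have [m_i0|m_i_gt0] := posnP (m i).
    suff -> : [lie partial i, monomial_field m k] = 0 by rewrite (linear0 T) (linear0 U) subrr.
    apply: der_ext => j; rewrite lieE !vfieldX derM !der_nat mul0r add0r subr0.
    by rewrite partialE mderivX m_i0 scale0r mulr0.
  have -> : [lie partial i, monomial_field m k]
      = (m i)%:R *: monomial_field (m - U_(i))%MM k.
    apply: der_ext => j; rewrite der_scaleE lieE !vfieldX derM !der_nat mul0r.
    by rewrite add0r subr0 partialE mderivX scalerAr.
  rewrite [T _]linearZ [U _]linearZ /= IHd ?subrr // -(ltn_add2r 1) -{1}(mdeg1 i) -mdegD.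
  rewrite addn1 (_ : (m - U_(i) + U_(i) = m)%MM) //.
  apply/mnmP => j; rewrite mnmDE mnmBE mnm1E.
  by case: eqP => [<-|_]; rewrite ?subn0 ?addn0 // subnK.
have euler_mon : [lie euler (fun=> 0), monomial_field m k]
    = (mdeg m)%:R *: monomial_field m k - monomial_field m k.
  apply: der_ext => j; rewrite der_addE der_oppE der_scaleE lieE !vfieldX derM.
  by rewrite derB der_mpolyC subr0 !vfieldX der_nat mul0r add0r euler0X scalerAr.
have euler_z : [lie euler (fun=> 0), z] = (mdeg m)%:R *: z - z.
  rewrite lie_diff // euler_mon [T _]linearB [U _]linearB /=.
  rewrite [T (_ *: _)]linearZ [U (_ *: _)]linearZ /= scalerBr.
  by rewrite !opprD addrACA.
have euler_z' : [lie euler (fun=> 0), z] = - z.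
  apply: der_ext => j; rewrite der_oppE lie_euler0X.
  rewrite euler0E big1 ?sub0r // => i _; move: (congr1 (fun D => D 'X_j) (partial_z i)).
  by rewrite lie_partialX => ->; rewrite mulr0.
move/eqP: euler_z; rewrite euler_z' -[X in X == _]add0r => /eqP/addIr/esym/eqP.
by rewrite scaler_eq0 (natrF_eq0 charF0) mdeg_eq0 (negPf m_neq0) => /eqP.
Qed.

End CharZeroWitt.

End Witt.

Arguments partial {F n} i.

(** * Values of a biderivation at a point *)

Section Biderivation.
Variables (F : fieldType) (charF0 : [pchar F] =i pred0) (n : nat).
Variables (delta : {bilinear Witt F n -> Witt F n -> Witt F n}).
Hypothesis bider : biderivation delta.

Let two_neq0 : 2%:R != 0 :> F.
Proof. by rewrite natrF_eq0. Qed.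

Lemma biderivation_derivationl z : lie_derivation (applyr delta z).
Proof.
by move=> a b; rewrite /= (bider.1 a b z) addrC (lie_antisym _ b) opprK.
Qed.

Lemma biderivation_derivationr z : lie_derivation (delta z).
Proof. exact: bider.2. Qed.

(** In [biderivation_lie4] take [x = quad c l], [u = d_i], [y = d_j], [v = E_c]. Then [[u, y] = 0],
    and [[x, v] = - x] makes the term with [delta u y] vanish at [c]; the other two terms are known
    there. *)
Lemma value_biderivation_partial_euler c i j l k :
  (j == l)%:R * value c (delta (partial i) (euler c)) k
  + (j == k)%:R * value c (delta (partial i) (euler c)) l
  = - ((i == l)%:R * value c (delta (euler c) (partial j)) k
       + (i == k)%:R * value c (delta (euler c) (partial j)) l).
Proof.
have /(congr1 (fun w => value c w k)) := biderivation_lie4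
  (quad c l) (partial i) (partial j) (euler c) bider.
rewrite lie_partial linear0l addr0 lie_partial_euler.
rewrite (lie_antisym (euler c) (quad c l)) lie_euler_quad lieNr.
rewrite (lie_antisym (quad c l) (delta _ _)) opprK.
rewrite (lie_antisym (partial j) (quad c l)) lieNl.
rewrite (lie_antisym (partial i) (delta _ _)).
rewrite valueD !valueN value_lie_quad add0r value_lie_partial_quad opprK => ->.
by rewrite (value_lie_partial_derivation_quad (biderivation_derivationl (partial j))).
Qed.

Lemma value_biderivation_partial_euler_offdiag c i k : k != i ->
  value c (delta (partial i) (euler c)) k = 0.
Proof.
(* With [j = l = k] the left side is twice the wanted value and the right side is zero. *)
move=> neq_ki; have := value_biderivation_partial_euler c i k k k.
rewrite eqxx !mul1r (eq_sym i) (negPf neq_ki) !mul0r addr0 oppr0 => /eqP.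
by rewrite -mulr2n -mulr_natl mulf_eq0 (negPf two_neq0) => /eqP.
Qed.

Lemma value_biderivation_euler_partial_offdiag c j k : k != j ->
  value c (delta (euler c) (partial j)) k = 0.
Proof.
move=> neq_kj; have := value_biderivation_partial_euler c k j k k.
rewrite eqxx !mul1r (eq_sym j) (negPf neq_kj) !mul0r addr0 => /esym/eqP.
by rewrite oppr_eq0 -mulr2n -mulr_natl mulf_eq0 (negPf two_neq0) => /eqP.
Qed.

(** Take [l = j] and [k = i]. Since [i] and [j] vary independently, both sides are one scalar
    depending only on [c]. *)
Lemma value_biderivation_diag c i j :
  value c (delta (partial i) (euler c)) i
  = - value c (delta (euler c) (partial j)) j.
Proof.
have := value_biderivation_partial_euler c i j j i.
have [->|neq_ij] := eqVneq i j.
  rewrite !eqxx !mul1r => /eqP; rewrite -addr_eq0 addrACA -mulr2n -mulr_natl.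
  by rewrite mulf_eq0 (negPf two_neq0) addr_eq0 => /eqP.
by rewrite !eqxx !mul1r !mul0r addr0 add0r.
Qed.

(** With [x = quad c k], [u = y = E_c], [v = d_k], the two sides of [biderivation_lie4] give [- 2 a]
    and [2 a] for the wanted value [a]. *)
Lemma value_biderivation_euler_euler c k :
  value c (delta (euler c) (euler c)) k = 0.
Proof.
have /(congr1 (fun w => value c w k)) := biderivation_lie4
  (quad c k) (euler c) (euler c) (partial k) bider.
rewrite liexx linear0l addr0 lie_euler_partial lieNr.
rewrite (lie_antisym (partial k) (quad c k)) lieNr.
rewrite -lie_antisym -(lie_antisym _ (partial k)).
rewrite (lie_antisym (euler c) (quad c k)) lie_euler_quad lieNl.
rewrite valueD valueN value_lie_quad subr0 value_lie_partial_quad.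
rewrite (value_lie_partial_derivation_quad (biderivation_derivationl (euler c))).
rewrite /= eqxx mul1r => /eqP; rewrite eq_sym -addr_eq0 -mulr2n -mulr_natl.
rewrite mulf_eq0 (negPf two_neq0) /= -mulr2n -mulr_natl mulf_eq0 (negPf two_neq0).
by move/eqP.
Qed.

(** * From values at points to polynomial identities *)

Let P i j := delta (partial i) (partial j).
Let R i := delta (partial i) (euler (fun=> 0)).
Let Q j := delta (euler (fun=> 0)) (partial j).

(** Component [k] of [delta d_i E_c] at the point [c], as a polynomial in [c]: the coefficients
    [c_j] of [euler_shift] become variables. *)
Let Rgen i k := R i 'X_k - \sum_j 'X_j * P i j 'X_k.
Let Qgen j k := Q j 'X_k - \sum_i 'X_i * P i j 'X_k.

Let Rgen_value c i k : (Rgen i k).@[c] = value c (delta (partial i) (euler c)) k.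
Proof.
rewrite euler_shift linearBr linear_sumr /value der_addE der_oppE der_sumE !mevalB.
congr (_ - _); rewrite !raddf_sum; apply: eq_bigr => j _.
by rewrite linearZr_LR der_scaleE /= mevalM mevalXU mevalZ.
Qed.

Let Qgen_value c j k : (Qgen j k).@[c] = value c (delta (euler c) (partial j)) k.
Proof.
rewrite euler_shift linearBl linear_sumlz /value der_addE der_oppE der_sumE !mevalB.
congr (_ - _); rewrite !raddf_sum; apply: eq_bigr => i _.
by rewrite linearZl_LR der_scaleE /= mevalM mevalXU mevalZ.
Qed.

Let Rgen_offdiag i k : k != i -> Rgen i k = 0.
Proof.
move=> neq_ki; apply: (mpoly_vanish_eq0 charF0) => c.
by rewrite Rgen_value value_biderivation_partial_euler_offdiag.
Qed.

Let Qgen_offdiag j k : k != j -> Qgen j k = 0.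
Proof.
move=> neq_kj; apply: (mpoly_vanish_eq0 charF0) => c.
by rewrite Qgen_value value_biderivation_euler_partial_offdiag.
Qed.

Let RQgen_diag i j : Rgen i i = - Qgen j j.
Proof.
apply/eqP; rewrite -addr_eq0; apply/eqP/(mpoly_vanish_eq0 charF0) => c.
by rewrite mevalD Rgen_value Qgen_value (value_biderivation_diag c i j) addNr.
Qed.

(** Expand [delta [d_i, E] d_j], where [[d_i, E] = d_i]; the [P i j] produced by the Euler bracket
    cancels the left side. *)
Let euler_P_Q i j k : euler (fun=> 0) (P i j 'X_k) = (Q j 'X_k)^`M(i).
Proof.
have := bider.1 (partial i) (euler (fun=> 0)) (partial j).
rewrite lie_partial_euler => /(congr1 (fun w : Witt F n => w 'X_k)).
rewrite der_addE der_oppE lie_partialX lie_euler0X opprB addrCA => /eqP.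
by rewrite -[X in X == _]addr0 (inj_eq (addrI _)) eq_sym subr_eq0 => /eqP/esym.
Qed.

Let euler_P_R i j k : euler (fun=> 0) (P i j 'X_k) = (R i 'X_k)^`M(j).
Proof.
have := bider.2 (partial i) (partial j) (euler (fun=> 0)).
rewrite lie_partial_euler (lie_antisym (euler _)).
move=> /(congr1 (fun w : Witt F n => w 'X_k)).
rewrite der_addE der_oppE lie_partialX lie_euler0X opprB -addrA => /eqP.
rewrite -[X in X == _]addr0 (inj_eq (addrI _)) eq_sym addrC subr_eq0.
by move=> /eqP/esym.
Qed.

(** By [euler_P_R], applying [E] to [R i] gives [\sum_j t_j E(P i j)], which cancels against the
    product rule; only the terms from [E t_j = t_j] survive. *)
Let euler_Rgen i k : euler (fun=> 0) (Rgen i k) = - \sum_j 'X_j * P i j 'X_k.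
Proof.
rewrite derB linear_sum /= euler0E -sumrB -sumrN; apply: eq_bigr => j _.
by rewrite derM vfieldX mpolyC0 subr0 euler_P_R opprD addrCA subrr addr0.
Qed.

Let euler_Qgen j k : euler (fun=> 0) (Qgen j k) = - \sum_i 'X_i * P i j 'X_k.
Proof.
rewrite derB linear_sum /= euler0E -sumrB -sumrN; apply: eq_bigr => i _.
by rewrite derM vfieldX mpolyC0 subr0 euler_P_Q opprD addrCA subrr addr0.
Qed.

(** * Constancy of [Lambda] and values on the generators *)

Variable i0 : 'I_n.

(** By [RQgen_diag] all diagonal entries of [Rgen] coincide, so the choice of [i0] is immaterial. *)
Let Lambda := Rgen i0 i0.

Let RgenE i k : Rgen i k = (i == k)%:R * Lambda.
Proof.
have [<-|neq_ik] := eqVneq i k; last by rewrite Rgen_offdiag 1?eq_sym // mul0r.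
by rewrite mul1r /Lambda (RQgen_diag i i0) (RQgen_diag i0 i0).
Qed.

Let QgenE j k : Qgen j k = - ((j == k)%:R * Lambda).
Proof.
have [<-|neq_jk] := eqVneq j k; last first.
  by rewrite Qgen_offdiag 1?eq_sym // mul0r oppr0.
by rewrite mul1r /Lambda (RQgen_diag i0 j) opprK.
Qed.

(* Compute [\sum_(i, j) t_i t_j P i j] by rows and by columns. *)
Let euler_Lambda : euler (fun=> 0) Lambda = 0.
Proof.
have rowP i k : \sum_j 'X_j * P i j 'X_k = - ((i == k)%:R * euler (fun=> 0) Lambda).
  by rewrite -[LHS]opprK -euler_Rgen RgenE derM der_nat mul0r add0r.
have colP j k : \sum_i 'X_i * P i j 'X_k = (j == k)%:R * euler (fun=> 0) Lambda.
  by rewrite -[LHS]opprK -euler_Qgen QgenE -[RHS]opprK linearN /= derM der_nat mul0r add0r opprK.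
have diag (x : {mpoly F[n]}) : \sum_i 'X_i * ((i == i0)%:R * x) = 'X_i0 * x.
  rewrite (bigD1 i0) //= eqxx mul1r big1 ?addr0 // => i /negPf ->.
  by rewrite mul0r mulr0.
have : \sum_i 'X_i * (\sum_j 'X_j * P i j 'X_i0)
     = \sum_j 'X_j * (\sum_i 'X_i * P i j 'X_i0).
  under eq_bigr do rewrite mulr_sumr.
  rewrite exchange_big; apply: eq_bigr => j _; rewrite mulr_sumr.
  by apply: eq_bigr => i _; rewrite mulrCA.
(* Rows give [- t_i0 E(Lambda)] and columns [t_i0 E(Lambda)], so twice this product is zero in an
   integral domain. *)
under eq_bigr do rewrite rowP; under [RHS]eq_bigr do rewrite colP.
under eq_bigr do rewrite mulrN; rewrite sumrN !diag => /eqP.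
rewrite eq_sym -addr_eq0 -mulr2n -mulr_natl -mpolyC_nat mul_mpolyC.
rewrite scaler_eq0 (negPf two_neq0) mulf_eq0 /= => /orP[/eqP X0|/eqP //].
have := congr1 (mderiv i0) X0.
by rewrite mderivU eqxx mderiv0 => /eqP; rewrite oner_eq0.
Qed.

Let lambda := Lambda@_0%MM.

Let LambdaE : Lambda = lambda%:MP. Proof. exact: euler0_eq0. Qed.

Let sum_P_row i k : \sum_j 'X_j * P i j 'X_k = 0.
Proof.
by rewrite -[LHS]opprK -euler_Rgen RgenE derM der_nat euler_Lambda mul0r mulr0 addr0 oppr0.
Qed.

Let sum_P_col j k : \sum_i 'X_i * P i j 'X_k = 0.
Proof.
by rewrite -[LHS]opprK -euler_Qgen QgenE linearN /= derM der_nat euler_Lambda mul0r mulr0 addr0 !oppr0.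
Qed.

Lemma biderivation_partial_euler i :
  delta (partial i) (euler (fun=> 0)) = lambda *: partial i.
Proof.
apply: der_ext => k; rewrite der_scaleE vfieldX.
(* Subtracting the vanishing row sum turns the component into [Rgen i k]. *)
by rewrite -[LHS]subr0 -(sum_P_row i k) -/(Rgen i k) RgenE LambdaE mulrC mul_mpolyC.
Qed.

Lemma biderivation_euler_partial j :
  delta (euler (fun=> 0)) (partial j) = - (lambda *: partial j).
Proof.
apply: der_ext => k; rewrite der_oppE der_scaleE vfieldX.
by rewrite -[LHS]subr0 -(sum_P_col j k) -/(Qgen j k) QgenE LambdaE mulrC mul_mpolyC.
Qed.

(** [R i] is now a constant field, so [E] kills the components of [P i a], which are therefore
    constant; differentiating the vanishing row sum by [t_j] leaves [P i j]. *)
Lemma biderivation_partial_partial i j : delta (partial i) (partial j) = 0.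
Proof.
have P_const k a : (P i a 'X_k)^`M(j) = 0.
  have /euler0_eq0 -> // : euler (fun=> 0) (P i a 'X_k) = 0; last by rewrite mderivC.
  rewrite euler_P_R /R biderivation_partial_euler der_scaleE vfieldX mderivZ.
  by rewrite -mpolyC_nat mderivC scaler0.
apply: der_ext => k; have /(congr1 (mderiv j)) := sum_P_row i k.
rewrite raddf_sum mderiv0 (bigD1 j) //= mderivM mderivU eqxx mul1r P_const mulr0.
rewrite addr0 big1 ?addr0 // => a /negPf neq_aj.
by rewrite mderivM mderivU eq_sym neq_aj mul0r P_const mulr0 addr0.
Qed.

(** Write [E_c = E - s] with [s] constant. In [delta E_c E_c] the cross terms [lambda s] cancel and
    [delta s s = 0], so [delta E E] vanishes at every [c]. *)
Lemma biderivation_euler_euler0 : delta (euler (fun=> 0)) (euler (fun=> 0)) = 0 :> Witt F n.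
Proof.
apply: der_ext => k; apply: (mpoly_vanish_eq0 charF0) => c.
rewrite -[RHS](value_biderivation_euler_euler c k) (euler_shift c).
set s := \sum_i _; rewrite linearBl !linearBr /=.
have -> : delta s (euler (fun=> 0)) = lambda *: s.
  rewrite linear_sumlz scaler_sumr; apply: eq_bigr => i _.
  by rewrite linearZl_LR biderivation_partial_euler !scalerA mulrC.
have -> : delta (euler (fun=> 0)) s = - (lambda *: s).
  rewrite linear_sumr scaler_sumr -sumrN; apply: eq_bigr => i _.
  by rewrite linearZr_LR biderivation_euler_partial scalerN !scalerA mulrC.
have -> : delta s s = 0.
  rewrite linear_sumlz big1 // => i _; rewrite linear_sumr big1 // => j _.
  by rewrite linearZl_LR linearZr_LR biderivation_partial_partial !scaler0.
by rewrite subr0 opprK addrK.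
Qed.

(** * Comparison with the Lie bracket *)

Lemma biderivation_lie_lambda x y : delta x y = lambda *: [lie x, y].
Proof.
pose ad (z : Witt F n) : {linear Witt F n -> Witt F n} :=
  HB.pack [eta lie z] (GRing.isLinear.Build _ _ _ _ [eta lie z] (lie_is_linearr z)).
pose adr (z : Witt F n) : {linear Witt F n -> Witt F n} :=
  HB.pack (lie^~ z) (GRing.isLinear.Build _ _ _ _ (lie^~ z) (lie_is_linearl z)).
have ad_derivation z : lie_derivation (ad z) by move=> a b; exact: lie_lie.
have adr_derivation z : lie_derivation (adr z).
  move=> a b; rewrite /= (lie_lie a b z) (lie_antisym b [lie a, z]).
  by rewrite addrC addrK.
have lieZl c a b : [lie c *: a, b] = c *: [lie a, b] :> Witt F n.
  exact: (@linearZl_LR _ _ _ _ _ _ (@lie F (Witt F n))).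
have lieZr c a b : [lie a, c *: b] = c *: [lie a, b] :> Witt F n.
  exact: (@linearZr_LR _ _ _ _ _ _ (@lie F (Witt F n))).
have derl z := biderivation_derivationl z.
(* Absorbing [lambda] into [x] makes the right side an inner derivation of [y]; each generator [y]
   is then settled by comparing derivations in [x]. *)
rewrite -lieZl.
apply: (lie_derivation_inj charF0 (T := delta x) (U := ad (lambda *: x))) => //.
- exact: biderivation_derivationr.
- move=> i; rewrite /= lieZl -lieZr.
  apply: (lie_derivation_inj charF0 (derl _) (adr_derivation _)) => [j|] /=.
    by rewrite biderivation_partial_partial lieZr lie_partial scaler0.
  by rewrite biderivation_euler_partial lieZr lie_euler_partial scalerN.
- rewrite /= lieZl -lieZr.
  apply: (lie_derivation_inj charF0 (derl _) (adr_derivation _)) => [j|] /=.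
    by rewrite biderivation_partial_euler lieZr lie_partial_euler.
  by rewrite biderivation_euler_euler0 lieZr liexx scaler0.
Qed.

End Biderivation.

Unset Implicit Arguments.

Theorem corollary4p4 (F : fieldType) (charF0 : [pchar F] =i pred0)
    (n : nat) (n_ge1 : (1 <= n)%N)
    (delta : {bilinear Witt F n -> Witt F n -> Witt F n})
    (bider : biderivation delta) :
  exists lambda : F, forall x y : Witt F n, delta x y = lambda *: [lie x, y].
Proof.
by eexists; apply: (biderivation_lie_lambda charF0 bider (Ordinal n_ge1)).
Qed.
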